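(* Let $k\geq 2$ be an integer. Then $ar(3k, kC_{3})=\binom{3k-1}{2}+1$.
   Context: An edge-coloring of a graph assigns a color to each edge; an edge-colored graph is rainbow if all colors on its edges are distinct. For a positive integer $n$ and a graph $F$, the anti-Ramsey number $ar(n,F)$ is the maximum number of colors in an edge-coloring of the complete graph $K_n$ containing no rainbow copy of $F$. $kC_3$ denotes the graph consisting of $k$ vertex-disjoint triangles. *)

(* Defs.v *)
From mathcomp Require Import all_boot.

Set Implicit Arguments.
Unset Strict Implicit.
Unset Printing Implicit Defensive.

Record sgraph := SGraph {
  vertex :> finType;
  adj : rel vertex;
  adj_sym : symmetric adj;
  adj_irr : irreflexive adj
}.

Definition edges (G : sgraph) : {set {set G}} :=
  [set [set u.1; u.2] | u : G * G & adj u.1 u.2].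

Section Complete.
Variable n : nat.
Definition complete_adj : rel 'I_n := [rel x y | x != y].
Lemma complete_sym : symmetric complete_adj.
Proof. by move=> x y; rewrite /complete_adj /= eq_sym. Qed.
Lemma complete_irr : irreflexive complete_adj.
Proof. by move=> x; rewrite /complete_adj /= eqxx. Qed.
Definition complete : sgraph := SGraph complete_sym complete_irr.
End Complete.

(* [ordS x] is the successor of [x] modulo [n]. *)
Section Cycle.
Variable n : nat.
Definition cycle_adj : rel 'I_n :=
  [rel x y | (x != y) && ((y == ordS x) || (x == ordS y))].
Lemma cycle_sym : symmetric cycle_adj.
Proof. by move=> x y; rewrite /cycle_adj /= eq_sym orbC. Qed.
Lemma cycle_irr : irreflexive cycle_adj.
Proof. by move=> x; rewrite /cycle_adj /= eqxx. Qed.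
Definition cycle_graph : sgraph := SGraph cycle_sym cycle_irr.
End Cycle.

Section Copies.
Variables (k : nat) (G : sgraph).
Definition copies_adj : rel ('I_k * G)%type :=
  [rel u v | (u.1 == v.1) && adj u.2 v.2].
Lemma copies_sym : symmetric copies_adj.
Proof. by move=> u v; rewrite /copies_adj /= eq_sym adj_sym. Qed.
Lemma copies_irr : irreflexive copies_adj.
Proof. by move=> u; rewrite /copies_adj /= adj_irr andbF. Qed.
Definition disjoint_copies : sgraph := SGraph copies_sym copies_irr.
End Copies.

(* An edge-colouring of K_n is a function on {set 'I_n}, of which only the    *)
(* values on the edges of K_n matter.                                         *)
Section Colouring.
Variables (n : nat) (T : eqType) (c : {set 'I_n} -> T).

Definition ncolours : nat :=
  size (undup [seq c e | e in edges (complete n)]).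

Definition rainbow (A : {set {set 'I_n}}) : bool := dinjectiveb c A.

Definition copy_edges (F : sgraph) (f : {ffun F -> 'I_n}) : {set {set 'I_n}} :=
  [set [set f x | x in e] | e : {set F} in edges F].

Definition has_rainbow_copy (F : sgraph) : bool :=
  [exists f : {ffun F -> 'I_n}, injectiveb f && rainbow (copy_edges f)].
End Colouring.

(* A colouring uses at most 'C(n, 2) colours, so a palette of that size       *)
(* suffices; [ar_upper] and [ar_attained] below show that [ar n F] is the     *)
(* maximum over colourings with an arbitrary palette.                         *)
Definition ar (n : nat) (F : sgraph) : nat :=
  \max_(c : {ffun {set 'I_n} -> 'I_('C(n, 2))} | ~~ has_rainbow_copy c F)
    ncolours c.

Lemma edges_complete n : edges (complete n) = [set A : {set 'I_n} | #|A| == 2].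
Proof.
apply/setP=> A; rewrite inE; apply/imsetP/cards2P.
- by case=> -[x y]; rewrite inE => xy ->; exists x, y.
- by case=> x [y [xy ->]]; exists (x, y); rewrite ?inE.
Qed.

Lemma card_edges_complete n : #|edges (complete n)| = 'C(n, 2).
Proof. by rewrite edges_complete card_draws card_ord. Qed.

Lemma copy_edges_sub n (F : sgraph) (f : {ffun F -> 'I_n}) :
  injective f -> copy_edges f \subset edges (complete n).
Proof.
move=> f_inj; apply/subsetP=> A /imsetP[e /imsetP[[x y] + ->] ->].
rewrite inE /= => xy; rewrite edges_complete inE card_imset // cards2.
by have [xy_eq|] := eqVneq x y; first by rewrite xy_eq adj_irr in xy.
Qed.

Lemma has_rainbow_copy_ext n (F : sgraph) (T T' : eqType)
    (c : {set 'I_n} -> T) (c' : {set 'I_n} -> T') :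
  {in edges (complete n) &, forall e e', c e = c e' -> c' e = c' e'} ->
  has_rainbow_copy c' F -> has_rainbow_copy c F.
Proof.
move=> cc' /existsP[f /andP[/injectiveP f_inj /dinjectiveP r]].
apply/existsP; exists f; apply/andP; split; first exact/injectiveP.
have /subsetP sub := copy_edges_sub f_inj.
by apply/dinjectiveP=> e e' he he' ee'; apply: r => //; apply: cc'; rewrite ?sub.
Qed.

Lemma ar_upper n (F : sgraph) (T : eqType) (c : {set 'I_n} -> T) :
  ~~ has_rainbow_copy c F -> ncolours c <= ar n F.
Proof.
move=> nr; pose s := undup [seq c e | e in edges (complete n)].
have sN : size s <= 'C(n, 2).
  by rewrite -card_edges_complete (leq_trans (size_undup _)) ?size_image.
have [s0|s_gt0] := posnP (size s); first by rewrite /ncolours -/s s0.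
have mem_s e : e \in edges (complete n) -> c e \in s.
  by move=> he; rewrite mem_undup; apply: image_f.
have N_gt0 : 0 < 'C(n, 2) := leq_trans s_gt0 sN.
pose c' : {ffun {set 'I_n} -> 'I_('C(n, 2))} :=
  [ffun e => insubd (Ordinal N_gt0) (index (c e) s)].
have c'E e : e \in edges (complete n) -> c' e = index (c e) s :> nat.
  move=> he; rewrite ffunE val_insubd ifT //.
  by apply: leq_trans sN; rewrite index_mem mem_s.
have cc' : {in edges (complete n) &, forall e e', c e = c e' -> c' e = c' e'}.
  by move=> e e' _ _ ee'; rewrite !ffunE ee'.
have nr' : ~~ has_rainbow_copy c' F.
  by apply: contra nr; apply: has_rainbow_copy_ext cc'.
suff le_c : ncolours c <= ncolours c'.
  by apply: leq_trans le_c _; rewrite /ar (bigD1 c') //= leq_maxl.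
pose s' := undup [seq c' e | e in edges (complete n)].
rewrite -[ncolours c]/(size s) -(size_iota 0 (size s)).
rewrite -[ncolours c']/(size s') -(size_map val s').
apply: uniq_leq_size; first exact: iota_uniq.
move=> i; rewrite mem_iota add0n /= => i_s.
have [x _|e0] := pickP (mem (edges (complete n))); last first.
  by move: s_gt0; rewrite /s /image_mem (eq_enum e0) enum0.
have := mem_nth (c x) i_s; rewrite mem_undup => /imageP[e he ei].
apply/mapP; exists (c' e); first by rewrite mem_undup; apply: image_f.
by rewrite /= c'E // -ei index_uniq ?undup_uniq.
Qed.

Lemma ar_attained n (F : sgraph) (T : eqType) (c0 : {set 'I_n} -> T) :
  ~~ has_rainbow_copy c0 F ->
  exists2 c : {set 'I_n} -> nat, ~~ has_rainbow_copy c F & ncolours c = ar n F.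
Proof.
move=> nr0.
have [/existsP[c nr]|] := boolP [exists c : {ffun {set 'I_n} -> 'I_('C(n, 2))},
    ~~ has_rainbow_copy c F].
  have [|c1 nr1 E] := @eq_bigmax_cond _
      [pred c : {ffun {set 'I_n} -> 'I_('C(n, 2))} | ~~ has_rainbow_copy c F]
      (fun c => ncolours c).
    by apply/card_gt0P; exists c.
  exists (fun e => c1 e : nat).
    by apply: contra nr1; apply: has_rainbow_copy_ext => e e' _ _ ->.
  rewrite /ar [RHS]E /ncolours -(size_map val (undup _)) -undup_map_inj.
    by rewrite -map_comp.
  exact: val_inj.
move=> /existsPn none.
have ar0 : ar n F = 0.
  by rewrite /ar big_pred0 // => c; rewrite (negbTE (none c)).
have := ar_upper nr0; rewrite ar0 leqn0 => /eqP /size0nil /undup_nil E0.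
have E1 : edges (complete n) = set0.
  apply/setP=> e; rewrite in_set0; apply/negbTE/negP=> he.
  have : c0 e \in [seq c0 e | e in edges (complete n)] by apply: image_f.
  by rewrite E0.
exists (fun=> 0).
  by apply: contra nr0; apply: has_rainbow_copy_ext => e e'; rewrite E1 inE.
by rewrite /ncolours E1 /image_mem enum_set0.
Qed.

(* Main.v *)
Require Import Defs.
From mathcomp Require Import all_boot perm zify.

(** Lower bound: give all edges at one vertex the same colour and all other
    edges private colours; a perfect triangle tiling uses two edges at that
    vertex.

    Upper bound: choose one edge of each colour. The graph H of unchosen pairs
    has at most 3k - 3 edges, and a rainbow tiling is a proper k-colouring of H
    with all classes of size 3. Such a colouring exists unless H is a clique
    K_(k+1), by induction on k. If some vertex v has degree at least 3, counting
    gives two nonadjacent non-neighbours of v, and these three vertices form a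
    class whose removal destroys at least 3 edges. If all degrees are at most 2
    and k >= 3, any balanced colouring is improved by swapping an end of a
    monochromatic edge with a suitable vertex; k = 2 is a finite check.

    If H is a clique, choose one of its edges f in place of the chosen edge of
    the same colour: the new graph of unchosen pairs contains H - f but not f,
    so it is not a clique with the same number of edges. *)

Set Implicit Arguments.
Unset Strict Implicit.
Unset Printing Implicit Defensive.

(** * Partitions into colour classes of size three *)

Section Balanced.
Variable T : finType.

Definition colour_class (A : {set T}) (g : T -> nat) i := [set x in A | g x == i].

(** The coerced boolean also empties every class of index at least [k], so that on [A] exactly the
    colours below [k] occur. *)
Definition balanced k (A : {set T}) (g : T -> nat) :=
  forall i, #|colour_class A g i| = 3 * (i < k).

Lemma balanced_cons k (A S : {set T}) g :
  S \subset A -> #|S| = 3 -> balanced k (A :\: S) g ->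
  balanced k.+1 A (fun x => if x \in S then 0 else (g x).+1).
Proof.
move=> sSA S3 bal [|i].
  rewrite ltnS leq0n muln1 -S3; apply: eq_card => x; rewrite !inE.
  by case: ifP => [/(subsetP sSA) ->|]; rewrite ?andbF.
rewrite ltnS -(bal i); apply: eq_card => x; rewrite !inE.
by case: ifP => //=; rewrite andbF.
Qed.

Lemma subset_of_card (A : {set T}) m :
  m <= #|A| -> exists2 S : {set T}, S \subset A & #|S| = m.
Proof.
move=> /card_geqP[s [us <- sA]]; exists [set x in s].
  by apply/subsetP=> x; rewrite inE => /sA.
by rewrite cardsE; apply/card_uniqP.
Qed.

(** Turns a list of colours found by the finite check into a colouring of [A], read along the
    enumeration of [A]. *)
Lemma card_class_nth (A : {set T}) (m : seq nat) i : size m = #|A| ->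
  #|colour_class A (fun x => nth 0 m (index x (enum A))) i| = count_mem i m.
Proof.
move=> sm; set s := enum A; have ss : size s = size m by rewrite sm cardE.
have {2}-> : m = [seq nth 0 m (index x s) | x <- s].
  apply: (@eq_from_nth _ 0) => [|j jm]; first by rewrite size_map ss.
  case Es : s ss => [|x0 s'] ss; first by rewrite -ss in jm.
  by rewrite -Es (nth_map x0) ?index_uniq ?enum_uniq // Es ss.
rewrite count_map -size_filter -(card_uniqP (filter_uniq _ (enum_uniq _))).
by apply: eq_card => x; rewrite !inE mem_filter mem_enum andbC.
Qed.
End Balanced.

Lemma balanced_exists (T : finType) k (A : {set T}) :
  #|A| = 3 * k -> exists g, balanced k A g.
Proof.
elim: k A => [|k IH] A cA.
  exists (fun=> 0) => i; rewrite muln0; apply/eqP; rewrite cards_eq0.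
  by move/eqP: cA; rewrite muln0 cards_eq0 => /eqP->; apply/eqP/setP=> x; rewrite !inE.
have [S sSA S3] : exists2 S : {set T}, S \subset A & #|S| = 3.
  by apply: subset_of_card; lia.
have [|g bal] := IH (A :\: S); first by rewrite cardsDS // cA S3; lia.
by eexists; apply: balanced_cons bal.
Qed.

Lemma leq_card_bigcup (I T : finType) (S : {set I}) (F : I -> {set T}) m :
  (forall i, i \in S -> #|F i| <= m) -> #|\bigcup_(i in S) F i| <= #|S| * m.
Proof.
move=> Fm; rewrite -sum_nat_const; elim/big_rec2: _ => [|i n U Si Un].
  by rewrite cards0.
by apply: leq_trans (leq_card_setU _ _) _; rewrite leq_add ?Fm.
Qed.

(** * Finite check on six vertices *)

Definition pairs6 := [seq p <- [seq (i, j) | i <- iota 0 6, j <- iota 0 6] | p.1 < p.2].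

(** A graph on six vertices is a word of 15 bits; allowing at most 3 true bits leaves 576 words to
    test instead of 2^15. *)
Fixpoint bitseqs n w : seq bitseq :=
  if n is n'.+1 then
    map (cons false) (bitseqs n' w) ++
    (if w is w'.+1 then map (cons true) (bitseqs n' w') else [::])
  else [:: [::]].

Lemma mem_bitseqs b w : count id b <= w -> b \in bitseqs (size b) w.
Proof.
elim: b w => //= x b IH w; rewrite mem_cat.
case: x => [|bw]; last by rewrite map_f ?IH.
by case: w => // w bw; rewrite map_f ?orbT ?IH.
Qed.

Definition splits6 := permutations [:: 0; 0; 0; 1; 1; 1].

Definition check6 (b : bitseq) :=
  let h i j := nth false b (index (i, j) pairs6) in
  has (fun p => has (fun l => [&& p.2 < l, h p.1 p.2, h p.1 l & h p.2 l]) (iota 0 6))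
      pairs6
  || has (fun m => all (fun p => h p.1 p.2 ==> (nth 0 m p.1 != nth 0 m p.2)) pairs6)
         splits6.

Lemma check6_all : all check6 (bitseqs 15 3).
Proof. by vm_compute. Qed.

Lemma six_vertices (h : rel nat) :
  count (fun p => h p.1 p.2) pairs6 <= 3 ->
  (exists i j l, [/\ i < j < 6, j < l < 6 & [&& h i j, h i l & h j l]]) \/
  exists2 m, perm_eq m [:: 0; 0; 0; 1; 1; 1] &
    forall i j, i < j < 6 -> h i j -> nth 0 m i != nth 0 m j.
Proof.
move=> hc; pose b := [seq h p.1 p.2 | p <- pairs6].
have hE i j : i < j < 6 -> (i, j) \in pairs6.
  case/andP=> ij j6; rewrite mem_filter ij; apply/allpairsP; exists (i, j).
  by rewrite !mem_iota; split=> //=; lia.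
have hb i j : i < j < 6 -> nth false b (index (i, j) pairs6) = h i j.
  move=> ij; rewrite (nth_map (0, 0)) ?index_mem ?hE //.
  by rewrite nth_index ?hE.
have := allP check6_all b (mem_bitseqs _); rewrite /check6 count_map => /(_ hc).
have inP p : p \in pairs6 -> p.1 < p.2 < 6.
  rewrite mem_filter => /andP[-> /allpairsP[[i j] [_ + ->]]].
  by rewrite mem_iota.
case/orP=> [/hasP[[i j] /inP ij /hasP[l]]|/hasP[m]].
  rewrite mem_iota /fst /snd in ij * => l6 /andP[jl]; rewrite !hb; try lia.
  by left; exists i, j, l; split=> //; lia.
rewrite mem_permutations => pm /allP mP; right; exists m => // i j ij hij.
by have := mP _ (hE _ _ ij); rewrite /= hb // hij.
Qed.

(** * Counting adjacent pairs *)

Section Arcs.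
Variables (T : finType) (e : rel T).
Hypotheses (e_sym : symmetric e) (e_irr : irreflexive e).
Implicit Types (A B K S X Y : {set T}) (g : T -> nat).

Definition nbrs A x := [set y in A | e x y].

(** Ordered pairs are counted, so [arcs A A] is twice the number of edges inside [A], and the bound
    [6 * k.-1] used below stands for [3 * k - 3] edges. *)
Definition arcs X Y := \sum_(x in X) #|nbrs Y x|.

Definition clique K := {in K &, forall x y, x != y -> e x y}.

Definition equitable k A g :=
  balanced k A g /\ {in A &, forall x y, e x y -> g x != g y}.

Lemma card_nbrs A x : #|nbrs A x| = \sum_(y in A) e x y.
Proof.
rewrite -sum1_card big_mkcond [RHS]big_mkcond; apply: eq_bigr => y _.
by rewrite inE; case: (y \in A); case: (e x y).
Qed.

Lemma arcsC X Y : arcs X Y = arcs Y X.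
Proof.
rewrite /arcs; under eq_bigr do rewrite card_nbrs; rewrite exchange_big.
by apply: eq_bigr => y _; rewrite card_nbrs; apply: eq_bigr => x _; rewrite e_sym.
Qed.

Lemma arcs_setD A B Y : B \subset A -> arcs A Y = arcs B Y + arcs (A :\: B) Y.
Proof. by move=> sBA; rewrite /arcs (big_setID B) (setIidPr sBA). Qed.

(** The pairs meeting [B] number twice the degree sum of [B], less the pairs inside [B]. That last
    term sits on the left to avoid truncated subtraction; it vanishes when [B] is independent. *)
Lemma arcs_splitD A B : B \subset A ->
  arcs A A + arcs B B = 2 * arcs B A + arcs (A :\: B) (A :\: B).
Proof.
move=> sBA; have := arcs_setD A sBA; have := arcs_setD B sBA.
have := arcs_setD (A :\: B) sBA.
by rewrite (arcsC A) (arcsC A B) (arcsC (A :\: B) B); lia.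
Qed.

Lemma arcs1 x Y : arcs [set x] Y = #|nbrs Y x|.
Proof. by rewrite /arcs big_set1. Qed.

Lemma arcs_eq0 X Y : arcs X Y = 0 -> {in X & Y, forall x y, e x y = false}.
Proof.
move=> /eqP; rewrite sum_nat_eq0 => /forall_inP h x y Xx Yy.
have := h x Xx; rewrite cards_eq0 => /eqP/setP/(_ y).
by rewrite !inE Yy.
Qed.

Lemma arcs_clique K : clique K -> arcs K K = #|K| * #|K|.-1.
Proof.
move=> cK; rewrite -sum_nat_const; apply: eq_bigr => x Kx.
rewrite (cardsD1 x K) Kx /=; apply: eq_card => y; rewrite !inE andbC.
have [->|nxy] := eqVneq y x; first by rewrite e_irr.
by case Ky: (y \in K); rewrite ?andbF // cK // eq_sym.
Qed.

Lemma arcs_indep S : {in S &, forall x y, e x y = false} -> arcs S S = 0.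
Proof.
move=> iS; apply: big1 => x Sx; apply/eqP; rewrite cards_eq0.
by apply/eqP/setP=> y; rewrite !inE; apply/andP=> -[Sy]; rewrite iS.
Qed.

Lemma nonadjacent_pair A : arcs A A < #|A| * #|A|.-1 ->
  exists x y, [/\ x \in A, y \in A, x != y & ~~ e x y].
Proof.
move=> lt.
have [/exists_inP[x Ax /exists_inP[y Ay /andP[xy nxy]]]|] :=
  boolP [exists x in A, [exists y in A, (x != y) && ~~ e x y]].
  by exists x, y.
move=> /exists_inPn none; rewrite arcs_clique ?ltnn // in lt.
move=> x y Ax Ay xy; have /exists_inPn/(_ y Ay) := none x Ax.
by rewrite xy negbK.
Qed.

(* [(k + 1) k >= 6 (k - 1)] since [(k - 2) (k - 3) >= 0]. *)
Lemma edges_in_clique k A K : K \subset A -> clique K -> #|K| = k.+1 ->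
  arcs A A <= 6 * k.-1 -> {in A &, forall x y, e x y -> x \in K}.
Proof.
move=> sKA cK cardK le x y Ax Ay exy; apply/negPn/negP=> nKx.
suff /arcs_eq0/(_ x y) : arcs (A :\: K) A = 0.
  by rewrite inE nKx Ax Ay exy => /(_ isT isT).
have := arcs_setD A sKA; have := arcs_setD K sKA; rewrite (arcsC A K).
have := arcs_clique cK; rewrite cardK /=.
suff : 6 * k.-1 <= k.+1 * k by lia.
by case: (k) => [|[|[|n]]] //=; nia.
Qed.

Lemma equitable_cons k A S g :
  S \subset A -> #|S| = 3 -> {in S &, forall x y, e x y = false} ->
  equitable k (A :\: S) g ->
  equitable k.+1 A (fun x => if x \in S then 0 else (g x).+1).
Proof.
move=> sSA S3 iS [bal col]; split; first exact: balanced_cons.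
move=> x y Ax Ay exy; case: ifP => Sx; case: ifP => Sy //.
  by rewrite iS in exy.
by rewrite eqSS col // inE ?Sx ?Sy.
Qed.

(** * Colour swaps when all degrees are at most two *)

Definition monochromatic A g :=
  [set u : T * T | [&& u.1 \in A, u.2 \in A, e u.1 u.2 & g u.1 == g u.2]].

Lemma balanced_swap k A g a x : a \in A -> x \in A -> balanced k A g ->
  balanced k A (fun y => g (tperm a x y)).
Proof.
move=> Aa Ax bal i; rewrite -(bal i) -(card_imset _ (@perm_inj _ (tperm a x))).
have tA y : (tperm a x y \in A) = (y \in A).
  by case: tpermP => [->|->|]; rewrite ?Aa ?Ax.
apply: eq_card => y; rewrite inE; apply/imsetP/idP => [[z]|].
  by rewrite inE => /andP[Az gz] ->; rewrite tA Az.
by exists (tperm a x y); rewrite ?tpermK // inE tA tpermK.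
Qed.

(* At most [3 + 1 + 2 + 2] vertices are excluded as partners of [a]. *)
Lemma swap_partner k A g a b : 8 < #|A| -> balanced k A g ->
  {in A, forall x, #|nbrs A x| <= 2} ->
  a \in A -> b \in A -> e a b -> g a = g b ->
  exists x, [/\ x \in A, g x != g a,
    {in A, forall y, y != a -> g y = g a -> e x y = false} &
    {in A, forall y, y != x -> g y = g x -> e a y = false}].
Proof.
move=> A8 bal deg Aa Ab eab gab.
have C3 i : #|colour_class A g i| <= 3 by rewrite bal; case: (i < k).
have ab : a != b by apply: contraTneq eab => ->; rewrite e_irr.
(* [X1] bars the class of [a]; [X2] and [X3] bar vertices that would clash with [b] or with the rest
   of that class; [X4] bars those whose class holds another neighbour of [a]. Since [a] and [b] are
   adjacent, each has at most one further neighbour. *)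
pose X1 := colour_class A g (g a).
pose X2 := nbrs A b :\ a.
pose X3 := \bigcup_(y in X1 :\ a :\ b) nbrs A y.
pose X4 := \bigcup_(y in nbrs A a :\ b) (colour_class A g (g y) :\ y).
have c1 : #|X1| <= 3 := C3 _.
have c2 : #|X2| <= 1.
  by have := deg b Ab; rewrite (cardsD1 a) inE Aa e_sym eab -/X2 add1n ltnS.
have c3 : #|X3| <= 1 * 2.
  apply: leq_trans (leq_card_bigcup (m := 2) _) _ => [y|].
    by rewrite !inE => /and4P[_ _ Ay _]; apply: deg.
  rewrite leq_mul2r /=; have := c1; rewrite (cardsD1 a X1) (cardsD1 b (X1 :\ a)).
  have -> : a \in X1 by rewrite inE Aa eqxx.
  have -> : b \in X1 :\ a by rewrite !inE Ab gab eqxx eq_sym ab.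
  by rewrite !addnA.
have c4 : #|X4| <= 1 * 2.
  apply: leq_trans (leq_card_bigcup (m := 2) _) _ => [y|].
    rewrite !inE => /and3P[_ Ay _]; have := C3 (g y).
    by rewrite (cardsD1 y) inE Ay eqxx; lia.
  by rewrite leq_mul2r /=; have := deg a Aa; rewrite (cardsD1 b) inE Ab eab; lia.
have /subsetPn[x Ax] : ~~ (A \subset X1 :|: X2 :|: X3 :|: X4).
  apply/negP=> /subset_leq_card.
  have := (leq_card_setU (X1 :|: X2 :|: X3) X4).1.
  have := (leq_card_setU (X1 :|: X2) X3).1.
  have := (leq_card_setU X1 X2).1.
  lia.
rewrite !in_setU !negb_or => /andP[/andP[/andP[n1 n2] n3] n4].
have gxa : g x != g a by move: n1; rewrite inE Ax.
have xa : x != a by apply: contraNneq gxa => ->.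
exists x; split=> // y Ay.
  move=> ya gy; apply/negP=> exy; have [yb|yb] := eqVneq y b.
    by move: n2; rewrite !inE xa Ax -yb e_sym exy.
  case/bigcupP: n3; exists y; first by rewrite !inE yb ya Ay gy eqxx.
  by rewrite inE Ax e_sym.
move=> yx gy; apply/negP=> eay; case/bigcupP: n4; exists y.
  rewrite !inE Ay eay !andbT; apply: contraNneq gxa => yb.
  by rewrite -gy yb gab.
by rewrite !inE Ax gy eqxx eq_sym yx.
Qed.

(** Descent on the number of monochromatic pairs. With [k >= 3] there are at least nine vertices,
    more than the eight that [swap_partner] may exclude. *)
Lemma equitable_maxdeg2 k A : #|A| = 3 * k -> 2 < k ->
  {in A, forall x, #|nbrs A x| <= 2} -> exists g, equitable k A g.
Proof.
move=> cA k3 deg; have [g bal] := balanced_exists cA.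
have [m] := ubnP #|monochromatic A g|; elim: m g bal => // m IH g bal lt_m.
have [/set0Pn[[a b]]|] := boolP (monochromatic A g != set0); last first.
  rewrite negbK => /eqP m0; exists g; split=> // x y Ax Ay exy.
  apply/negP=> gxy; have : (x, y) \in monochromatic A g.
    by rewrite inE Ax Ay exy.
  by rewrite m0 inE.
rewrite inE /= => /and4P[Aa Ab eab /eqP gab].
have [|x [Ax gxa h1 h2]] := @swap_partner k A g a b _ bal deg Aa Ab eab gab.
  by lia.
have xa : x != a by apply: contraNneq gxa => ->.
have ab : a != b by apply: contraTneq eab => ->; rewrite e_irr.
have xb : x != b by apply: contraNneq gxa => ->; rewrite gab.
apply: IH (balanced_swap Aa Ax bal) _; rewrite -ltnS; apply: leq_trans lt_m.
(* The swap loses the pair [(a, b)]. A new monochromatic pair would join [a] to the old class of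
   [x], or [x] to the old class of [a], against [h2] and [h1]. *)
rewrite ltnS; apply/proper_card/properP; split; last first.
  exists (a, b); first by rewrite inE Aa Ab eab gab /=.
  by rewrite inE /= tpermL tpermD // Aa Ab eab -gab (negbTE gxa).
apply/subsetP=> -[u w]; rewrite !inE /= => /and4P[Au Aw euw].
rewrite Au Aw euw; case: tpermP => [ua|ux|/eqP ua /eqP ux];
  case: tpermP => [wa|wx|/eqP wa /eqP wx] //=; move: euw; rewrite ?ua ?ux ?wa ?wx.
- by rewrite e_irr.
- by rewrite (negbTE gxa).
- by move=> + /eqP gw; rewrite h2.
- by rewrite eq_sym (negbTE gxa).
- by rewrite e_irr.
- by move=> + /eqP gw; rewrite h1.
- by rewrite e_sym => + /eqP gw; rewrite h2.
- by rewrite e_sym => + /eqP gw; rewrite h1.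
Qed.

(** * The case of two classes *)

Lemma equitable_six A : #|A| = 6 -> arcs A A <= 6 ->
  (exists g, equitable 2 A g) \/
  exists K, [/\ K \subset A, clique K & #|K| = 3].
Proof.
move=> cA le6; have ss : size (enum A) = 6 by rewrite -cardE.
have [x0 Ax0] : exists x, x \in A by apply/card_gt0P; rewrite cA.
pose h i j := e (nth x0 (enum A) i) (nth x0 (enum A) j).
have inA i : i < 6 -> nth x0 (enum A) i \in A.
  by move=> i6; rewrite -mem_enum mem_nth ?ss.
have [|[i [j [l [ij jl /and3P[hij hil hjl]]]]]|[m pm mP]] := @six_vertices h.
(* In the expanded double sum the diagonal vanishes and each unordered pair counts twice, so at most
   three of the fifteen bits are true. *)
- have : \sum_(x <- enum A) \sum_(y <- enum A) e x y <= 6.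
    by rewrite big_enum; under eq_bigr do rewrite big_enum -card_nbrs.
  rewrite /h /pairs6; move: (enum A) ss => [|y0 [|y1 [|y2 [|y3 [|y4 [|y5 [|]]]]]]] //= _.
  rewrite !big_cons !big_nil !e_irr.
  rewrite !(e_sym _ y0) !(e_sym y2 y1) !(e_sym y3 y1) !(e_sym y4 y1) !(e_sym y5 y1).
  rewrite !(e_sym y3 y2) !(e_sym y4 y2) !(e_sym y5 y2) !(e_sym y4 y3) !(e_sym y5 y3).
  by rewrite !(e_sym y5 y4); do 15! [move: (nat_of_bool _) => ?]; lia.
- right; exists [set nth x0 (enum A) i; nth x0 (enum A) j; nth x0 (enum A) l].
  have neq u v : u < v < 6 -> (nth x0 (enum A) u == nth x0 (enum A) v) = false.
    by move=> uv; rewrite nth_uniq ?enum_uniq ?ss; lia.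
  split.
  + by apply/subsetP=> x; rewrite !inE => /orP[/orP[]|] /eqP->; apply: inA; lia.
  + by move=> x y; rewrite !inE => /orP[/orP[]|] /eqP-> /orP[/orP[]|] /eqP->;
      rewrite ?eqxx // => _; rewrite // e_sym.
  + by rewrite -setUA !cardsU1 cards1 !inE !neq; lia.
- left; exists (fun x => nth 0 m (index x (enum A))); split=> [c|x y Ax Ay exy].
    rewrite card_class_nth ?(seq.perm_size pm) // (seq.permP pm).
    by case: c => [|[|c]].
  have ix z : z \in A -> index z (enum A) < 6 by rewrite -ss index_mem mem_enum.
  have nx z : z \in A -> nth x0 (enum A) (index z (enum A)) = z.
    by move=> Az; rewrite nth_index ?mem_enum.
  have [lt|lt|eq] := ltngtP (index x (enum A)) (index y (enum A)).
  + by apply: mP; rewrite ?lt ?ix // /h !nx.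
  + by rewrite eq_sym; apply: mP; rewrite ?lt ?ix // /h !nx // e_sym.
  + by move: exy; rewrite -(nx x Ax) eq nx // e_irr.
Qed.

(** * Induction on the number of classes *)

Lemma nbrs_nonnbrs A v : v \in A ->
  #|nbrs A v| + #|[set y in A | (y != v) && ~~ e v y]| = #|A|.-1.
Proof.
move=> Av; rewrite (cardsD1 v A) Av succnK -(cardsID [set y | e v y] (A :\ v)).
apply: (f_equal2 addn); apply: eq_card => y; rewrite !inE.
  by have [->|] := eqVneq y v; rewrite ?e_irr ?andbF.
by case: (y \in A); rewrite ?andbF //= andbT andbC.
Qed.

Lemma arcs_sub X A : X \subset A -> arcs X X <= arcs A A.
Proof.
move=> sXA; have := arcs_setD A sXA; have := arcs_setD X sXA.
by rewrite (arcsC A X); lia.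
Qed.

(** No edge at [v] lies inside [B], and each one is counted in both directions. *)
Lemma arcs_vertex A B v : v \in A -> B \subset A :\ v ->
  2 * #|nbrs A v| + arcs B B <= arcs A A.
Proof.
move=> Av /arcs_sub le; have sv : [set v] \subset A by rewrite sub1set.
have := arcs_splitD sv; rewrite (arcs1 v A) (@arcs_indep [set v]); first lia.
by move=> x y /set1P-> /set1P->.
Qed.

(** An edge meeting an independent triple has exactly one end in it, so the three degrees add up
    without correction. *)
Lemma arcs_remove3 A v y z : v \in A -> y \in A -> z \in A ->
  v != y -> v != z -> y != z -> ~~ e v y -> ~~ e v z -> ~~ e y z ->
  let S := [set v; y; z] in
  [/\ S \subset A, #|S| = 3, {in S &, forall x y, e x y = false} &
   arcs A A = 2 * (#|nbrs A v| + #|nbrs A y| + #|nbrs A z|)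
              + arcs (A :\: S) (A :\: S)].
Proof.
move=> Av Ay Az vy vz yz evy evz eyz S.
have sSA : S \subset A.
  by apply/subsetP=> x; rewrite !inE => /orP[/orP[]|] /eqP->.
have iS : {in S &, forall x y, e x y = false}.
  move=> a b; rewrite !inE => /orP[/orP[]|] /eqP-> /orP[/orP[]|] /eqP->;
    rewrite ?e_irr //; try exact: negbTE; rewrite e_sym; exact: negbTE.
split=> //; first by rewrite /S -setUA !cardsU1 cards1 !inE negb_or vy vz yz.
have := arcs_splitD sSA; rewrite (arcs_indep iS) addn0 => ->.
rewrite {1}/arcs /S -setUA !big_setU1 ?inE ?negb_or ?vy ?vz ?yz //= big_set1.
by rewrite addnA.
Qed.

(** If removing the first triple leaves a clique that blocks the induction, all estimates are tight:
    every edge is at [v] or inside the clique. Then either [v] extends the clique, or a second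
    triple, made of [v], a clique vertex and an outside vertex, leaves too few edges for a blocking
    clique. *)
Lemma equitable_or_clique k A :
  0 < k -> #|A| = 3 * k -> arcs A A <= 6 * k.-1 ->
  (exists g, equitable k A g) \/
  exists K, [/\ K \subset A, clique K & #|K| = k.+1].
Proof.
elim: k A => // -[|k] IH A _ cA le.
  left; exists (fun=> 0); split=> [[|i]|x y Ax Ay exy] /=.
  - by rewrite -cA; apply: eq_card => x; rewrite !inE andbT.
  - by apply/eqP; rewrite cards_eq0; apply/eqP/setP=> x; rewrite !inE andbF.
  - have a0 : arcs A A = 0 by apply/eqP; rewrite -leqn0.
    by rewrite (arcs_eq0 a0) in exy.
have [/exists_inP[v Av dv]|/exists_inPn maxdeg] :=
  boolP [exists v in A, 2 < #|nbrs A v|]; last first.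
  have {}maxdeg : {in A, forall x, #|nbrs A x| <= 2}.
    by move=> x Ax; have := maxdeg x Ax; rewrite -leqNgt.
  case: k IH cA le => [|k] _ cA le; first exact: equitable_six.
  by left; apply: equitable_maxdeg2 maxdeg.
pose N := [set y in A | (y != v) && ~~ e v y].
have cN := nbrs_nonnbrs Av; rewrite -/N in cN.
have sNA : N \subset A by apply/subsetP=> y; rewrite inE => /andP[].
have leAvN : 2 * #|nbrs A v| + arcs N N <= arcs A A.
  by apply: arcs_vertex => //; apply/subsetP=> y; rewrite !inE => /and3P[-> ->].
(* With [m = #|N|], the edge bound leaves [arcs N N <= 2 * m - 4]; hence [m >= 2], and
   [2 * m - 4 < m * (m - 1)]. *)
have [|y [z [Ny Nz yz eyz]]] := @nonadjacent_pair N.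
  move: cN leAvN le; rewrite cA; clear.
  by case: #|N| => [|[|n]]; nia.
move: (Ny) (Nz); rewrite !inE => /and3P[Ay yv evy] /and3P[Az zv evz].
have [||sSA S3 iS arcsA] := @arcs_remove3 A v y z Av Ay Az _ _ yz evy evz eyz;
  rewrite 1?eq_sym //.
set S := [set v; y; z] in sSA S3 iS arcsA.
have cAS : #|A :\: S| = 3 * k.+1 by rewrite cardsDS // cA S3 mulnS addKn.
have [|[g eg]|[K [sKA cK cardK]]] := IH (A :\: S) isT cAS.
- by clear -arcsA le dv; lia.
- by left; eexists; apply: equitable_cons eg.
have nvK : v \notin K.
  by apply/negP=> /(subsetP sKA); rewrite !inE eqxx.
have sKAv : K \subset A :\ v.
  apply/subsetP=> x Kx; rewrite !inE; apply/andP; split.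
    by apply: contraNneq nvK => <-.
  by have := subsetP sKA x Kx; rewrite inE => /andP[].
have {}sKA : K \subset A := subset_trans sKAv (subsetDl _ _).
have arcsK : arcs K K = k.+2 * k.+1 by rewrite arcs_clique // cardK.
have dK := arcs_vertex Av sKAv.
(* The bounds amount to [(k - 1) * (k - 2) <= 0] over the integers, and at both roots they hold with
   equality. *)
have [k12 d3 arcs6] : [/\ (k == 1) || (k == 2), #|nbrs A v| = 3 & arcs A A = 6 * k.+1].
  move: dK le dv; rewrite arcsK succnK; clear.
  by case: k => [|[|[|n]]] dK le dv; split=> //; nia.
have [/subsetP KN|/subsetPn[a Ka nva]] := boolP (K \subset nbrs A v).
  right; exists (v |: K); split; rewrite ?subUset ?sub1set ?Av //.
    move=> x w; rewrite !inE => /predU1P[->|Kx] /predU1P[->|Kw]; rewrite ?eqxx //.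
    - by have := KN w Kw; rewrite inE => /andP[].
    - by have := KN x Kx; rewrite inE e_sym => /andP[].
    - exact: cK.
  by rewrite cardsU1 nvK cardK.
(* The excluded set has at most [1 + (k + 2) + 3] elements, fewer than [3 * k + 6] because
   [k >= 1]. *)
have [w Aw] : exists w, w \in A :\: (v |: (K :|: nbrs A v)).
  apply/card_gt0P; have := (leq_card_setU [set v] (K :|: nbrs A v)).1.
  have := (leq_card_setU K (nbrs A v)).1.
  have := cardsID (v |: (K :|: nbrs A v)) A.
  have := subset_leq_card (subsetIr A (v |: (K :|: nbrs A v))).
  by rewrite cards1 cardK d3 cA; clear -k12; lia.
move: Aw; rewrite !inE !negb_or => /andP[/and3P[wv nwK nvw] Aw].
rewrite Aw /= in nvw.
have Aa := subsetP sKA a Ka.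
have nva' : ~~ e v a by move: nva; rewrite inE Aa.
have av : a != v by apply: contraTneq Ka => ->.
have aw : a != w by apply: contraTneq Ka => ->.
(* The edges at [v] and inside [K] already exhaust [arcs A A], so [w] has no neighbour in [K]. *)
have nwa : ~~ e a w.
  have swK : w |: K \subset A :\ v.
    by rewrite subUset sKAv sub1set !inE wv Aw.
  have sK : K \subset (w |: K) :\ w.
    apply/subsetP=> x Kx; rewrite !inE Kx orbT andbT.
    by apply: contraNneq nwK => <-.
  have le1 := arcs_vertex Av swK; have le2 := arcs_vertex (setU11 w K) sK.
  have : nbrs (w |: K) w == set0.
    rewrite -cards_eq0; clear -k12 le1 le2 arcsK arcs6 d3;
    by case/orP: k12 => /eqP k_eq; subst k; lia.
  by move/eqP/setP/(_ a); rewrite !inE Ka orbT /= e_sym => ->.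
have dega : k.+1 <= #|nbrs A a|.
  have -> : k.+1 = #|K :\ a| by have := cardsD1 a K; rewrite Ka cardK => -[].
  apply/subset_leq_card/subsetP=> x; rewrite !inE => /andP[xa Kx].
  by rewrite (subsetP sKA) // cK // eq_sym.
have [||sSA' S3' iS' arcsA'] := @arcs_remove3 A v a w Av Aa Aw _ _ aw nva' nvw nwa;
  rewrite 1?eq_sym //.
set S' := [set v; a; w] in sSA' S3' iS' arcsA'.
have cAS' : #|A :\: S'| = 3 * k.+1 by rewrite cardsDS // cA S3' mulnS addKn.
have [|[g eg]|[K' [sK' cK' cardK']]] := IH (A :\: S') isT cAS'.
- by clear -arcsA' le d3 dega; lia.
- by left; eexists; apply: equitable_cons eg.
(* At most [4 * k - 2] ordered pairs survive, whereas [K'] would need [(k + 2) * (k + 1)]. *)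
have := arcs_sub sK'; rewrite (arcs_clique cK') cardK' /=.
by case/orP: k12 => /eqP k_eq; move: arcsA' dega; rewrite arcs6 d3 k_eq; clear; lia.
Qed.
End Arcs.

(** * From edge-colourings to graphs of unchosen pairs *)

Section Rainbow.
Variables (n : nat) (C : eqType) (c : {set 'I_n} -> C).

(** The graph H of the overview, for the set [R] of chosen edges. *)
Definition missing (R : {set {set 'I_n}}) : rel 'I_n :=
  [rel x y | (x != y) && ([set x; y] \notin R)].

Lemma missing_sym R : symmetric (missing R).
Proof. by move=> x y; rewrite /missing /= eq_sym setUC. Qed.

Lemma missing_irr R : irreflexive (missing R).
Proof. by move=> x; rewrite /missing /= eqxx. Qed.

Lemma rainbow_representatives : exists R : {set {set 'I_n}},
  [/\ R \subset edges (complete n), rainbow c R, ncolours c <= #|R| &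
      {in edges (complete n), forall f, exists2 f', f' \in R & c f' = c f}].
Proof.
set E := edges (complete n).
(* On edges, [r f] depends only on the colour of [f], which makes the set of representatives
   rainbow; the default [f] is never taken there. *)
pose r f := odflt f [pick f' in E | c f' == c f].
have rP f : f \in E -> r f \in E /\ c (r f) = c f.
  rewrite /r => Ef; case: pickP => [f' /andP[Ef' /eqP cf']|/(_ f)]; first by split.
  by rewrite Ef eqxx.
have r_eq f f' : f \in E -> c f = c f' -> r f = r f'.
  move=> Ef cff'; rewrite /r.
  have -> : [pick a in E | c a == c f] = [pick a in E | c a == c f'].
    by apply: eq_pick => a; rewrite cff'.
  by case: pickP => // /(_ f); rewrite Ef cff' eqxx.
exists (r @: E); split.
- by apply/subsetP=> _ /imsetP[f Ef ->]; case: (rP f Ef).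
- apply/dinjectiveP=> _ _ /imsetP[f Ef ->] /imsetP[f' Ef' ->].
  by case: (rP f Ef) (rP f' Ef') => _ -> [_ ->]; apply: r_eq.
- rewrite cardE -(size_map c); apply: uniq_leq_size; first exact: undup_uniq.
  move=> a; rewrite mem_undup => /imageP[f Ef ->].
  by case: (rP f Ef) => _ <-; apply: map_f; rewrite mem_enum imset_f.
- by move=> f Ef; exists (r f); [rewrite imset_f | case: (rP f Ef)].
Qed.

Lemma arcs_missing (R : {set {set 'I_n}}) : R \subset edges (complete n) ->
  arcs (missing R) setT setT <= 2 * ('C(n, 2) - #|R|).
Proof.
move=> sRE; rewrite -card_edges_complete -cardsDS // mulnC -sum_nat_const.
rewrite /arcs; under eq_bigr do rewrite card_nbrs.
rewrite pair_big /= (eq_bigl xpredT); last by move=> u; rewrite !inE.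
rewrite (eq_bigr (fun u => if missing R u.1 u.2 then 1 else 0)); last first.
  by move=> u _; case: (missing _ _ _).
rewrite -big_mkcond /=.
(* Ordered missing pairs are grouped by their underlying edge, at most two to each. *)
rewrite (partition_big (fun u => [set u.1; u.2]) (mem (edges (complete n) :\: R))) /=.
  apply: leq_sum => f; rewrite inE edges_complete inE => /andP[_ /cards2P[a [b [ab ->]]]].
  rewrite sum1_card; apply: leq_trans (_ : #|[set (a, b); (b, a)]| <= 2).
    apply/subset_leq_card/subsetP=> -[x y]; rewrite !inE /= => /andP[/andP[xy _] /eqP xyE].
    have := set21 x y; have := set22 x y; rewrite xyE => /set2P[] Ey /set2P[] Ex;
      move: xy; by rewrite Ex Ey ?eqxx ?orbT.
  by rewrite cards2; case: eqP.
by move=> -[x y] /= /andP[xy nR]; rewrite in_setD nR edges_complete inE cards2 xy.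
Qed.

(** The [i]-th triangle is placed on the [i]-th class. No pair inside a class is missing, so all
    triangle edges belong to the rainbow set [R]. *)
Lemma equitable_rainbow k (R : {set {set 'I_n}}) (g : 'I_n -> nat) : 0 < n ->
  rainbow c R -> equitable (missing R) k setT g ->
  has_rainbow_copy c (disjoint_copies k (cycle_graph 3)).
Proof.
move=> n_gt0 /dinjectiveP c_inj [bal col].
pose cl (i : 'I_k) := enum (colour_class setT g i).
pose f := [ffun u : disjoint_copies k (cycle_graph 3) =>
  nth (Ordinal n_gt0) (cl u.1) u.2].
have s_cl i : size (cl i) = 3 by rewrite -cardE bal ltn_ord.
have gf u : g (f u) = u.1.
  rewrite ffunE; set x := nth _ _ _.
  have : x \in cl u.1 by rewrite mem_nth ?s_cl.
  by rewrite mem_enum inE => /andP[_ /eqP].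
have f_inj : injective f.
  move=> -[i j] [i' j'] E; have := gf (i, j); rewrite E gf /= => /val_inj ii'.
  move: E; rewrite ii' !ffunE /= => /eqP.
  by rewrite nth_uniq ?s_cl ?enum_uniq // => /eqP /val_inj ->.
apply/existsP; exists f; apply/andP; split; first exact/injectiveP.
apply/dinjectiveP; have sub : {subset copy_edges f <= R}; last first.
  by move=> a b /sub Ra /sub Rb; apply: c_inj.
move=> _ /imsetP[_ /imsetP[[u v] + ->] ->]; rewrite inE /= => /andP[/eqP uv1 uv2].
rewrite imsetU !imset_set1; apply/negPn/negP=> nR.
have := col (f u) (f v) (in_setT _) (in_setT _); rewrite /missing /= nR andbT !gf uv1 eqxx.
rewrite (inj_eq f_inj); case: eqVneq uv2 => [->|_ _ /(_ isT)] //.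
by case/andP; rewrite eqxx.
Qed.
End Rainbow.

(** * The upper bound *)

Lemma rainbow_or_clique k (C : eqType) (c : {set 'I_(3 * k)} -> C)
    (R : {set {set 'I_(3 * k)}}) :
  2 <= k -> R \subset edges (complete (3 * k)) -> rainbow c R ->
  'C(3 * k - 1, 2) + 1 < #|R| ->
  has_rainbow_copy c (disjoint_copies k (cycle_graph 3)) \/
  exists K : {set 'I_(3 * k)}, [/\ clique (missing R) K, #|K| = k.+1 &
    forall x y, missing R x y -> x \in K].
Proof.
move=> k2 sRE cR ltR.
have le : arcs (missing R) setT setT <= 6 * k.-1.
  apply: leq_trans (arcs_missing sRE) _.
  (* Pascal's rule: the binomials differ by [3 * k - 1], and [R] exceeds the smaller one by at least
     2, so at most [3 * k - 3] pairs are missing. *)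
  have binE : 'C(3 * k, 2) = 'C(3 * k - 1, 2) + (3 * k - 1).
    by have := binS (3 * k - 1) 1; rewrite bin1 subn1 prednK //; lia.
  by rewrite binE; lia.
have k_gt0 : 0 < k by lia.
have cT : #|[set: 'I_(3 * k)]| = 3 * k by rewrite cardsT card_ord.
have [[g eg]|[K [sK cK cardK]]] :=
  equitable_or_clique (missing_sym R) (missing_irr R) k_gt0 cT le.
  by left; apply: equitable_rainbow cR eg; lia.
right; exists K; split=> // x y.
exact: (edges_in_clique (missing_sym R) (missing_irr R) sK cK cardK le).
Qed.

Lemma rainbow_triangles k (C : eqType) (c : {set 'I_(3 * k)} -> C) :
  2 <= k -> 'C(3 * k - 1, 2) + 1 < ncolours c ->
  has_rainbow_copy c (disjoint_copies k (cycle_graph 3)).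
Proof.
move=> k2 ltc; have [R [sRE cR leR repR]] := rainbow_representatives c.
have ltR := leq_trans ltc leR.
have [//|[K [cK cardK inK]]] := rainbow_or_clique k2 sRE cR ltR.
have [x [y [Kx Ky xy]]] : exists x y, [/\ x \in K, y \in K & x != y].
  by apply/card_gt1P; rewrite cardK; lia.
(* [K] has at least three vertices. The pairs [xz] and [yz] stay missing after the exchange, which
   forces [x] and [y] into the new clique, although [xy] is by then chosen. *)
have [z] : exists z, z \in K :\ x :\ y.
  apply/card_gt0P; have := cardsD1 y (K :\ x); have := cardsD1 x K.
  by rewrite !inE Kx Ky eq_sym xy cardK /=; lia.
rewrite !inE => /and3P[zy zx Kz].
pose f := [set x; y].
have nRf : f \notin R by have /andP[] := cK x y Kx Ky xy.
have Ef : f \in edges (complete (3 * k)) by rewrite edges_complete inE cards2 xy.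
have [f' Rf' cf'] := repR f Ef.
pose R' := f |: (R :\ f').
have cardR' : #|R'| = #|R|.
  by rewrite cardsU1 in_setD1 (negbTE nRf) andbF (cardsD1 f' R) Rf'.
have sR'E : R' \subset edges (complete (3 * k)).
  by rewrite subUset sub1set Ef (subset_trans (subsetDl _ _) sRE).
have cR' : rainbow c R'.
  move/dinjectiveP: cR => c_inj; apply/dinjectiveP=> a b.
  rewrite !inE => /predU1P[->|/andP[af' Ra]] /predU1P[->|/andP[bf' Rb]] //.
  - by rewrite -cf' => /(c_inj _ _ Rf' Rb) fb; rewrite fb eqxx in bf'.
  - by rewrite -cf' => /(c_inj _ _ Ra Rf') fa; rewrite fa eqxx in af'.
  - exact: c_inj.
rewrite -cardR' in ltR.
have [//|[K' [cK' _ inK']]] := rainbow_or_clique k2 sR'E cR' ltR.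
have missR' a : a \in K -> a != z -> z \notin f -> missing R' a z.
  move=> Ka az zf; have /andP[_ nR] := cK a z Ka Kz az.
  rewrite /missing /= az !inE (negbTE nR) andbF orbF.
  by apply: contraNneq zf => <-; rewrite set22.
have zf : z \notin f by rewrite !inE negb_or zx zy.
have Kx' : x \in K' by apply: inK' (missR' x Kx _ zf); rewrite eq_sym.
have Ky' : y \in K' by apply: inK' (missR' y Ky _ zf); rewrite eq_sym.
by have := cK' x y Kx' Ky' xy; rewrite /missing /= setU11 andbF.
Qed.

(** * The lower bound *)

Definition star_colouring n (v : 'I_n) (f : {set 'I_n}) : {set 'I_n} :=
  if v \in f then set0 else f.

Lemma ncolours_star n (v : 'I_n) : 2 <= n ->
  'C(n - 1, 2) + 1 <= ncolours (star_colouring v).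
Proof.
move=> n2; set D := [set f : {set 'I_n} | f \subset [set~ v] & #|f| == 2].
have cD : #|D| = 'C(n - 1, 2) by rewrite cards_draws cardsC1 card_ord subn1.
have D0 : set0 \notin D by rewrite inE cards0 andbF.
(* The added 1 is absorbed as the element [set0], the shared colour of the edges at [v]; it is not
   an edge, so it differs from every private colour. *)
rewrite -cD addn1 -add1n -[1]/(true : nat) -D0 -cardsU1 cardE.
apply: uniq_leq_size => [|f]; first exact: enum_uniq.
rewrite mem_enum mem_undup => /setU1P[->|].
  have [w vw] : exists w, w \in [set~ v].
    by apply/card_gt0P; rewrite cardsC1 card_ord; lia.
  apply/imageP; exists [set v; w]; last by rewrite /star_colouring set21.
  by move: vw; rewrite edges_complete !inE cards2 eq_sym => ->.
rewrite inE => /andP[/subsetP fv f2]; apply/imageP; exists f.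
  by rewrite edges_complete inE.
by rewrite /star_colouring ifN //; apply/negP=> /fv; rewrite !inE eqxx.
Qed.

Lemma star_no_rainbow k (v : 'I_(3 * k)) :
  ~~ has_rainbow_copy (star_colouring v) (disjoint_copies k (cycle_graph 3)).
Proof.
apply/existsP=> -[f /andP[/injectiveP f_inj /dinjectiveP c_inj]].
(* The copy has as many vertices as the host graph, so [f] is onto and some triangle passes through
   [v]. *)
have /codomP[[i j] vE] : v \in codom f.
  apply: inj_card_onto f_inj _ _.
  by rewrite card_prod !card_ord mulnC.
have adj3 (a b : 'I_3) : a != b -> cycle_adj a b.
  by case: a => -[|[|[|//]]] ?; case: b => -[|[|[|//]]] ?.
have edge (j' : 'I_3) : j' != j -> [set f (i, j); f (i, j')] \in copy_edges f.
  move=> j'j; apply/imsetP; exists [set (i, j); (i, j')].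
    apply/imsetP; exists ((i, j), (i, j')) => //.
    by rewrite inE; apply/andP; split=> //; apply: adj3; rewrite eq_sym.
  by rewrite imsetU !imset_set1.
have [j1 [j2 [j1j j2j j12]]] : exists j1 j2 : 'I_3, [/\ j1 != j, j2 != j & j1 != j2].
  have /card_gt1P[j1 [j2 [h1 h2 h12]]] : 1 < #|[set~ j]| by rewrite cardsC1 card_ord.
  by exists j1, j2; split=> //; [move: h1 | move: h2]; rewrite !inE.
have := c_inj _ _ (edge j1 j1j) (edge j2 j2j).
rewrite /star_colouring vE !set21 => /(_ erefl) E.
have : f (i, j1) \in [set f (i, j); f (i, j2)] by rewrite -E set22.
rewrite !inE => /orP[] /eqP /f_inj [] e; first by rewrite e eqxx in j1j.
by rewrite e eqxx in j12.
Qed.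

Theorem theorem1p2 (k : nat) (hk : 2 <= k) :
  ar (3 * k) (disjoint_copies k (cycle_graph 3)) = 'C(3 * k - 1, 2) + 1.
Proof.
apply/eqP; rewrite eqn_leq; apply/andP; split.
  apply/bigmax_leqP=> c; rewrite leqNgt; apply: contra.
  exact: rainbow_triangles.
have n_gt0 : 0 < 3 * k by lia.
apply: leq_trans (ar_upper (star_no_rainbow (Ordinal n_gt0))).
by apply: ncolours_star; lia.
Qed.
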